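(* Let $1\le N\le K$ be integers, let $\epsilon>0$, and let $M=\{\mu_{n,k}\}$ and $\hat M=\{\hat\mu_{n,k}\}$ ($n\in[N]$, $k\in[K]$) be any two mean reward matrices such that $|\mu_{n,k}-\hat\mu_{n,k}|\le\epsilon$ for all $n\in[N]$, $k\in[K]$. Let $\pi^*$ and $\hat\pi^*$ be optimal assignments for $M$ and $\hat M$ respectively, i.e. $\pi^*\in\arg\max_{\pi\in\Pi} f(M,\pi)$ and $\hat\pi^*\in\arg\max_{\pi\in\Pi} f(\hat M,\pi)$. Then $$-2N\epsilon\le f(M,\pi^* )-f(M,\hat\pi^* )\le 2N\epsilon .$$
   Context: $[m]=\{1,\dots,m\}$. A mean reward matrix is an $N\times K$ matrix whose entries are means of $[0,1]$-valued rewards. $\Pi$ is the set of assignments, i.e. injective maps $\pi:[N]\to[K]$. For a matrix $M=\{\mu_{n,k}\}$ and $\pi\in\Pi$, $f(M,\pi):=\sum_{i\in[N]}\mu_{i,\pi(i)}$. *)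

(* Defs.v *)
From HB Require Import structures.
From mathcomp Require Import all_boot all_order all_algebra.
From mathcomp Require Import all_classical all_reals all_analysis.

Set Implicit Arguments.
Unset Strict Implicit.
Unset Printing Implicit Defensive.

Import Order.TTheory GRing.Theory Num.Theory.
Local Open Scope classical_set_scope.
Local Open Scope ring_scope.

(* The index sets {1, ..., N} and {1, ..., K} are encoded as 'I_N and 'I_K. *)

Definition is_mean_reward (R : realType) (mu : R) : Prop :=
  exists (d : measure_display) (T : measurableType d) (P : probability T R)
         (X : {RV P >-> R}),
    (forall t : T, 0 <= X t <= 1) /\ ('E_P[X] = mu%:E)%E.

(* Only the individual means matter: each entry has its own reward variable,
   and no joint law of the rewards is prescribed. *)
Definition mean_reward_matrix (R : realType) (N K : nat) (M : 'M[R]_(N, K)) :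
    Prop :=
  forall (n : 'I_N) (k : 'I_K), is_mean_reward (M n k).

Definition assignments (N K : nat) : set ('I_N -> 'I_K) :=
  [set pi | injective pi].

Definition total_reward (R : realType) (N K : nat) (M : 'M[R]_(N, K))
    (pi : 'I_N -> 'I_K) : R :=
  \sum_(i < N) M i (pi i).

Definition optimal_assignments (R : realType) (N K : nat) (M : 'M[R]_(N, K)) :
    set ('I_N -> 'I_K) :=
  [set pi | assignments pi /\
     forall sigma : 'I_N -> 'I_K, assignments sigma ->
       total_reward M sigma <= total_reward M pi].

(* Main.v *)
(* Changing every entry by at most eps moves the value of each assignment by at
   most N eps; comparing pistar and pihat through their values under Mhat, where
   pihat is at least as good, costs this error twice. *)
Require Import Defs.
From HB Require Import structures.
From mathcomp Require Import all_boot all_order all_algebra.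
From mathcomp Require Import all_classical all_reals all_analysis.
From mathcomp Require Import lra.

Set Implicit Arguments.
Unset Strict Implicit.
Unset Printing Implicit Defensive.

Import Order.TTheory GRing.Theory Num.Theory.
Local Open Scope ring_scope.

(** Triangle inequality over the [N] rows: row [i] contributes only the error of its entry at
    [pi i]. *)
Lemma total_reward_close (R : realType) (N K : nat) (eps : R)
    (M M' : 'M[R]_(N, K)) (pi : 'I_N -> 'I_K) :
  (forall n k, `|M n k - M' n k| <= eps) ->
  `|total_reward M pi - total_reward M' pi| <= N%:R * eps.
Proof.
move=> close; rewrite /total_reward -sumrB.
apply: (le_trans (ler_norm_sum _ _ _)).
apply: (le_trans (ler_sum _ (fun i _ => close i (pi i)))).
by rewrite sumr_const card_ord mulr_natl.
Qed.

Theorem theorem1 (R : realType) (N K : nat) (hN : (1 <= N)%N) (hNK : (N <= K)%N)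
    (eps : R) (heps : 0 < eps) (M Mhat : 'M[R]_(N, K))
    (hM : mean_reward_matrix M) (hMhat : mean_reward_matrix Mhat)
    (hclose : forall (n : 'I_N) (k : 'I_K), `|M n k - Mhat n k| <= eps)
    (pistar pihat : 'I_N -> 'I_K)
    (hpistar : optimal_assignments M pistar)
    (hpihat : optimal_assignments Mhat pihat) :
  - (2 * N%:R * eps) <= total_reward M pistar - total_reward M pihat
    <= 2 * N%:R * eps.
Proof.
have [star_inj star_max] := hpistar.
have [hat_inj hat_max] := hpihat.
have hat_le_star := star_max _ hat_inj.
have star_le_hat := hat_max _ star_inj.
have := total_reward_close pistar hclose.
have := total_reward_close pihat hclose.
(* For the lower bound: the difference is already nonnegative by optimality of [pistar]. *)
have Neps_ge0 : 0 <= N%:R * eps by rewrite mulr_ge0 // ltW.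
rewrite -mulrA !ler_norml => /andP[? ?] /andP[? ?].
(* The upper bound chains [M] to [Mhat] at [pistar], then [star_le_hat], then [Mhat] back to [M] at
   [pihat], with [N%:R * eps] as a single unknown. *)
by apply/andP; split; lra.
Qed.
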